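(* Let $d,m,r$ be positive integers, $\sigma,\tau_s,\tau_g>0$, and let $\phi,\psi:\mathbb{R}\to\mathbb{R}$ be measurable functions with $\mathbb{E}\phi(G)^2<\infty$ and $\mathbb{E}\psi(G)^2<\infty$ for Gaussian $G$. Let $W_i\in\mathbb{R}^{m\times d}$, $W_g,W_u\in\mathbb{R}^{r\times d}$, $W_o\in\mathbb{R}^{d\times m}$, $\widetilde W_o\in\mathbb{R}^{d\times r}$ be independent random matrices with i.i.d. entries, those of $W_i,W_g,W_u$ distributed $\mathcal{N}(0,\sigma^2)$, those of $W_o$ distributed $\mathcal{N}(0,\tau_s^2)$ and those of $\widetilde W_o$ distributed $\mathcal{N}(0,\tau_g^2)$. Define $$F_{\mathrm{single}}(x)=W_o\phi(W_ix),\qquad F_{\mathrm{gate}}(x)=\widetilde W_o\big[\psi(W_gx)\odot W_ux\big],$$ with $\phi,\psi$ applied entrywise and $\odot$ the entrywise product. Fix $x\in\mathbb{R}^d$, let $\nu=\sigma^2\|x\|_2^2$, let $G_\nu\sim\mathcal{N}(0,\nu)$, and let $P_{\mathrm{out}}\in\mathbb{R}^{d\times d}$ be an orthogonal projector. Then $$\mathbb{E}\|P_{\mathrm{out}}F_{\mathrm{single}}(x)\|_2^2=\operatorname{rank}(P_{\mathrm{out}})\,\tau_s^2\,m\,\mathbb{E}\phi(G_\nu)^2,$$ $$\mathbb{E}\|P_{\mathrm{out}}F_{\mathrm{gate}}(x)\|_2^2=\operatorname{rank}(P_{\mathrm{out}})\,\tau_g^2\,r\,\nu\,\mathbb{E}\psi(G_\nu)^2,$$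 and hence, whenever $\operatorname{rank}(P_{\mathrm{out}})\ge1$ and $\mathbb{E}\phi(G_\nu)^2>0$, $$\frac{\mathbb{E}\|P_{\mathrm{out}}F_{\mathrm{gate}}(x)\|_2^2}{\mathbb{E}\|P_{\mathrm{out}}F_{\mathrm{single}}(x)\|_2^2}=\rho_0:=\frac{\tau_g^2}{\tau_s^2}\,\frac{r}{m}\,\frac{\nu\,\mathbb{E}\psi(G_\nu)^2}{\mathbb{E}\phi(G_\nu)^2}.$$
   Context: $F_{\mathrm{single}}$ models a single-branch feed-forward network (e.g. GELU) of hidden width $m$ and $F_{\mathrm{gate}}$ a multiplicative gated feed-forward network (e.g. SwiGLU/GEGLU) of gated width $r$, both at random Gaussian initialization; expectations are over the random weights. An orthogonal projector satisfies $P=P^\top=P^2$. *)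

(* Defs.v *)
From HB Require Import structures.
From mathcomp Require Import all_boot all_order all_algebra.
From mathcomp Require Import all_classical all_reals all_analysis.
Set Implicit Arguments. Unset Strict Implicit. Unset Printing Implicit Defensive.
Import Order.TTheory GRing.Theory Num.Theory.
Local Open Scope classical_set_scope.
Local Open Scope ring_scope.

Definition sqnorm {R : realType} {n : nat} (v : 'cV[R]_n) : R :=
  \sum_(i < n) (v i 0) ^+ 2.

Definition orth_projector {R : realType} {n : nat} (P : 'M[R]_n) : Prop :=
  P^T = P /\ P *m P = P.

Definition F_single {R : realType} {d m : nat} (phi : R -> R)
  (Wi : 'M[R]_(m, d)) (Wo : 'M[R]_(d, m)) (x : 'cV[R]_d) : 'cV[R]_d :=
  Wo *m map_mx phi (Wi *m x).

Definition F_gate {R : realType} {d r : nat} (psi : R -> R)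
  (Wg Wu : 'M[R]_(r, d)) (Wo' : 'M[R]_(d, r)) (x : 'cV[R]_d) : 'cV[R]_d :=
  Wo' *m map2_mx (fun a b => psi a * b) (Wg *m x) (Wu *m x).

(* E f(G_nu) for G_nu ~ N(0, nu) (nu = variance); for nu = 0, G_0 = 0 a.s.
   (normal_prob takes the standard deviation, and normal_prob 0 0 is NOT
   the Dirac mass, hence the case split). *)
Definition gauss_expect {R : realType} (nu : R) (f : R -> R) : \bar R :=
  if nu == 0 then (f 0)%:E
  else (\int[normal_prob 0 (Num.sqrt nu)]_y (f y)%:E)%E.

Definition mutually_independent {dT : measure_display} {T : measurableType dT}
  {R : realType} (P : probability T R) {I : finType} (X : I -> T -> R) : Prop :=
  forall B : I -> set R, (forall i, measurable (B i)) ->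
    P (\bigcap_(i in [set: I]) (X i @^-1` B i)) =
    (\prod_(i : I) P (X i @^-1` B i))%E.

(* X is a (measurable) real random variable with law N(0, s^2), s = std dev *)
Definition gaussian_rv {dT : measure_display} {T : measurableType dT}
  {R : realType} (P : probability T R) (s : R) (X : T -> R) : Prop :=
  measurable_fun [set: T] X /\
  forall A : set R, measurable A -> P (X @^-1` A) = normal_prob 0 s A.

Definition entry_index (d m r : nat) : finType :=
  (('I_m * 'I_d) + ('I_r * 'I_d) + ('I_r * 'I_d) + ('I_d * 'I_m) + ('I_d * 'I_r))%type.

Definition all_entries {T : Type} {R : realType} {d m r : nat}
  (Wi : T -> 'M[R]_(m, d)) (Wg Wu : T -> 'M[R]_(r, d))
  (Wo : T -> 'M[R]_(d, m)) (Wo' : T -> 'M[R]_(d, r))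
  (k : entry_index d m r) : T -> R :=
  match k with
  | inl (inl (inl (inl (i, j)))) => fun w => Wi w i j
  | inl (inl (inl (inr (i, j)))) => fun w => Wg w i j
  | inl (inl (inr (i, j))) => fun w => Wu w i j
  | inl (inr (i, j)) => fun w => Wo w i j
  | inr (i, j) => fun w => Wo' w i j
  end.

(* Main.v *)
Require Import Defs.
From HB Require Import structures.
From mathcomp Require Import all_boot all_order all_algebra.
From mathcomp Require Import all_classical all_reals all_analysis.
From mathcomp Require Import measurable_realfun.
From mathcomp Require Import ring lra.
Import Order.TTheory GRing.Theory Num.Theory.
Local Open Scope classical_set_scope.
Local Open Scope ring_scope.

Set Implicit Arguments.
Unset Strict Implicit.
Unset Printing Implicit Defensive.

(* Write [h] for the hidden vector, [W] for the output matrix and [P] for the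
   projector. Expanding [|P W h|^2] yields monomials [W_a W_b h_l h_l'] whose
   factors belong to one independent family; every monomial with [a <> b] has
   zero mean, and the diagonal ones contribute [tau^2 E h_l^2] each, with total
   weight [\sum_ij P_ij^2 = tr P = rank P]. The hidden vector is independent of
   [W] because disjoint blocks of an independent family can be merged, and its
   preactivations are centered normal of variance [nu] because independent
   centered normal variables add up to a centered normal variable. *)

(** * Independent families *)

(** The hypothesis speaks of single matrix entries, through a product formula over the full index
    set, whereas the argument needs independence of functions of several entries. Merging only two
    variables at a time keeps the measure theory on [R * R], where rectangles determine a finite
    measure; arbitrary blocks follow by iteration. Laws are indexed by their variance and include
    the point mass at 0, because [x] or some of its coordinates may vanish. No moment of a hidden
    neuron beyond the second is available. This is enough: each variable of the independent family
    occurs at most twice in a monomial. For the gated network, [E h_l^2] needs one more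
    factorization: the gate and the linear preactivation of a neuron come from different rows, hence
    are independent, and the linear one contributes the factor [nu]. *)

Section independence.
Context {dT : measure_display} {T : measurableType dT} {R : realType}.
Variable P : probability T R.

(** Rectangles form a pi-system generating the product sigma-algebra; since [m1] is finite, the
    constant sequence [setT] serves as exhaustion. *)
Lemma eq_measure_rectangles (d1 d2 : measure_display) (T1 : measurableType d1)
    (T2 : measurableType d2) (m1 m2 : {measure set (T1 * T2) -> \bar R}) :
  (m1 [set: T1 * T2] < +oo)%E ->
  (forall A B, measurable A -> measurable B -> m1 (A `*` B) = m2 (A `*` B)) ->
  forall S, measurable S -> m1 S = m2 S.
Proof.
move=> m1oo m12 S mS.
apply: (measure_unique [set A `*` B | A in measurable & B in measurable]
  (fun=> setT)) => //.
- exact: measurable_prod_measurableType.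
- move=> _ _ [A mA [B mB <-]] [C mC [D mD <-]].
  exists (A `&` C); first exact: measurableI.
  by exists (B `&` D); [exact: measurableI|rewrite setXI].
- by move=> _; exists setT => //; exists setT => //; rewrite setXTT.
- by rewrite bigcup_const.
- by move=> _ [A mA [B mB <-]]; exact: m12.
Qed.

(** For fixed [E] both sides are finite measures in [S]: the law of the pair under [P] restricted to
    [E], and its law under [P] scaled by [P E]. They agree on rectangles by hypothesis. *)
Lemma independent_pair_event (U V : T -> R) (E : set T) :
  measurable_fun [set: T] U -> measurable_fun [set: T] V -> measurable E ->
  (forall A B, measurable A -> measurable B ->
    P (U @^-1` A `&` V @^-1` B `&` E) = (P (U @^-1` A `&` V @^-1` B) * P E)%E) ->
  forall S : set (R * R), measurable S ->
    P ((fun w => (U w, V w)) @^-1` S `&` E) =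
    (P ((fun w => (U w, V w)) @^-1` S) * P E)%E.
Proof.
move=> mU mV mE UVE S mS.
have mUV : measurable_fun setT (fun w => (U w, V w)) by exact/measurable_fun_pair.
have PE0 : 0 <= fine (P E) by rewrite fine_ge0.
pose m1 := pushforward (mrestr P mE) (fun w => (U w, V w))
  : {measure set (R * R) -> \bar R}.
pose m2 := pushforward P (fun w => (U w, V w))
  : {measure set (R * R) -> \bar R}.
have PEE : P E = (fine (P E))%:E by rewrite fineK// fin_num_measure.
have m12 := @eq_measure_rectangles _ _ _ _ (m1 mUV) (mscale (NngNum PE0) (m2 mUV)).
have {}m12 : m1 mUV S = mscale (NngNum PE0) (m2 mUV) S.
  apply: m12 => //.
    rewrite /m1 /= /pushforward /mrestr preimage_setT setTI.
    by rewrite (le_lt_trans (probability_le1 P mE))// ltry.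
  move=> A B mA mB; rewrite /m1 /m2 /= /pushforward /mrestr /mscale /=.
  by rewrite -PEE muleC -UVE.
by move: m12; rewrite /m1 /m2 /= /pushforward /mrestr /mscale /= -PEE muleC.
Qed.

Lemma measurable_inv (U : T -> R) A :
  measurable_fun [set: T] U -> measurable A -> measurable (U @^-1` A).
Proof. by move=> mU mA; rewrite -[X in measurable X]setTI; exact: mU. Qed.

Lemma probability_preimage_cst (c : R) (A : set R) :
  P ((fun=> c) @^-1` A) = (c \in A)%:R%:E.
Proof.
rewrite preimage_cst; case: ifP => _; first exact: probability_setT.
exact: measure0.
Qed.

(** Big operators on both sides make [bigD1], [bigID] and reindexing applicable to the events. *)
Lemma independent_bigcap (I : finType) (X : I -> T -> R) :
  mutually_independent P X <-> forall B : I -> set R, (forall i, measurable (B i)) ->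
    P (\big[setI/setT]_i (X i @^-1` B i)) = (\prod_i P (X i @^-1` B i))%E.
Proof.
have E (B : I -> set R) : \bigcap_(i in [set: I]) (X i @^-1` B i) =
    \big[setI/setT]_i (X i @^-1` B i).
  rewrite -bigcap_seq; congr bigcap; apply/seteqP.
  by split=> i //= _; rewrite mem_index_enum.
by split=> h B mB; rewrite -h// E.
Qed.

Section merge.
Variables (K : finType) (X : K -> T -> R) (a b : K).
Hypotheses (ab : a != b) (mX : forall k, measurable_fun [set: T] (X k)).
Hypothesis indX : mutually_independent P X.

Let rest (C : K -> set R) : set T :=
  \big[setI/setT]_(k | (k != a) && (k != b)) (X k @^-1` C k).

Let factor_rest (C : K -> set R) A B : (forall k, measurable (C k)) ->
    measurable A -> measurable B ->
  P (X a @^-1` A `&` X b @^-1` B `&` rest C) =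
  (P (X a @^-1` A) * P (X b @^-1` B) *
   \prod_(k | (k != a) && (k != b)) P (X k @^-1` C k))%E.
Proof.
move=> mC mA mB.
pose D k := if k == a then A else if k == b then B else C k.
have mD k : measurable (D k) by rewrite /D; case: ifP => // _; case: ifP.
have /independent_bigcap/(_ D mD) := indX.
rewrite (bigD1 a)//= (bigD1 b)/=; last by rewrite eq_sym.
rewrite [in RHS](bigD1 a)//= [in RHS](bigD1 b)/=; last by rewrite eq_sym.
have Da : D a = A by rewrite /D eqxx.
have Db : D b = B by rewrite /D eq_sym (negbTE ab) eqxx.
have DC k : (k != a) && (k != b) -> D k = C k.
  by rewrite /D => /andP[/negbTE-> /negbTE->].
rewrite Da Db setIA muleA => H.
have -> : rest C = \big[setI/setT]_(k | (k != a) && (k != b)) (X k @^-1` D k).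
  by apply: eq_bigr => k /DC->.
by rewrite H; congr (_ * _)%E; apply: eq_bigr => k /DC->.
Qed.

(* [X a] is absorbed into [X b] and replaced by [0], not removed, so that the
   index type does not change when merging is iterated. *)
Lemma independent_merge (f : R -> R -> R) :
  measurable_fun [set: R * R] (fun z => f z.1 z.2) ->
  mutually_independent P (fun k => if k == a then fun=> 0
    else if k == b then fun w => f (X a w) (X b w) else X k).
Proof.
move=> mf; apply/independent_bigcap => B mB.
rewrite (bigD1 a)//= (bigD1 b)/=; last by rewrite eq_sym.
rewrite [in RHS](bigD1 a)//= [in RHS](bigD1 b)/=; last by rewrite eq_sym.
rewrite !eqxx (eq_sym b) (negbTE ab).
rewrite (eq_bigr (fun k => X k @^-1` B k)); last first.
  by move=> k /andP[/negbTE-> /negbTE->].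
rewrite [X in _ = (_ * (_ * X))%E](eq_bigr (fun k => P (X k @^-1` B k))); last first.
  by move=> k /andP[/negbTE-> /negbTE->].
(* The emptied slot [a] holds the constant 0, so its event is either everything or empty; in the
   second case both sides vanish. *)
rewrite probability_preimage_cst preimage_cst.
case: ifPn => _; last by rewrite set0I measure0 mul0e.
rewrite setTI mul1e -/(rest B).
have mrest : measurable (rest B).
  by apply: bigsetI_measurable => k _; exact: measurable_inv.
have restE : P (rest B) =
    (\prod_(k | (k != a) && (k != b)) P (X k @^-1` B k))%E.
  have := @factor_rest B setT setT mB measurableT measurableT.
  by rewrite !preimage_setT !setTI probability_setT !mul1e.
rewrite -restE.
apply: (@independent_pair_event (X a) (X b) (rest B) _ _ mrest _
  ((fun z => f z.1 z.2) @^-1` B b)) => //.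
- move=> A C mA mC; rewrite factor_rest// restE; congr (_ * _)%E.
  have := @factor_rest (fun=> setT) A C (fun=> measurableT) mA mC.
  rewrite /rest big1; last by move=> k _; rewrite preimage_setT.
  rewrite setIT => ->; rewrite big1 ?mule1// => k _.
  by rewrite preimage_setT probability_setT.
- by rewrite -[X in measurable X]setTI; exact: mf.
Qed.

End merge.

(** Indices outside the image of [h] receive the event [setT], which changes neither the
    intersection nor the product. *)
Lemma independent_sub (I J : finType) (X : I -> T -> R) (h : J -> I) :
  injective h -> mutually_independent P X ->
  mutually_independent P (fun j => X (h j)).
Proof.
move=> hI /independent_bigcap indX; apply/independent_bigcap => B mB.
pose D i := if [pick j | h j == i] is Some j then B j else setT.
have mD i : measurable (D i) by rewrite /D; case: pickP.
have Dh j : D (h j) = B j.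
  by rewrite /D; case: pickP => [k /eqP/hI->//|/(_ j)]; rewrite eqxx.
have DN i : i \notin h @: [set: J]%SET -> D i = setT.
  move=> /imsetP ih; rewrite /D; case: pickP => // j /eqP hj.
  by exfalso; apply: ih; exists j.
have := indX D mD.
rewrite (bigID (mem (h @: [set: J]%SET)))/= [X in _ `&` X]big1 => [|i /DN->]; last first.
  by rewrite preimage_setT.
rewrite setIT [in RHS](bigID (mem (h @: [set: J]%SET)))/=.
rewrite [X in _ = (_ * X)%E]big1 => [|i /DN->]; last first.
  by rewrite preimage_setT probability_setT.
rewrite mule1 !big_imset/=; [|by move=> ? ? _ _; exact: hI..].
under eq_bigl do rewrite inE; under [in X in _ = X -> _]eq_bigl do rewrite inE.
by under eq_bigr do rewrite Dh; under [in X in _ = X -> _]eq_bigr do rewrite Dh.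
Qed.

(** Supplies the empty accumulators, all equal to the neutral value, from which [independent_block]
    starts. *)
Lemma independent_cst (I J : finType) (X : I -> T -> R) (c : R) :
  mutually_independent P X ->
  mutually_independent P (fun k : I + J =>
    match k with inl i => X i | inr _ => fun=> c end).
Proof.
move=> /independent_bigcap indX; apply/independent_bigcap => B mB.
rewrite !big_sumType/= -(indX (fun i => B (inl i)))//.
have [cB|] := boolP [forall j, c \in B (inr j)].
  rewrite [X in _ `&` X]big1 => [|j _]; last first.
    by rewrite preimage_cst (forallP cB j).
  rewrite setIT [X in (_ * X)%E]big1 ?mule1// => j _.
  by rewrite probability_preimage_cst (forallP cB j).
rewrite negb_forall => /existsP[j /negbTE cBj].
rewrite (bigD1 j)//= preimage_cst cBj set0I setI0 measure0.
by rewrite [X in _ = (_ * X)%E](bigD1 j)//= probability_preimage_cst cBj mul0e mule0.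
Qed.

Lemma measurable_big (I : eqType) (op : R -> R -> R) (idx : R) (F : I -> T -> R)
    (s : seq I) (Q : pred I) :
  measurable_fun [set: R * R] (fun z => op z.1 z.2) ->
  (forall i, measurable_fun [set: T] (F i)) ->
  measurable_fun [set: T] (fun w => \big[op/idx]_(i <- s | Q i) F i w).
Proof.
move=> mop mF; elim: s => [|i s IH].
  by under eq_fun do rewrite big_nil; exact: measurable_cst.
under eq_fun do rewrite big_cons.
case: (Q i) => //.
pose g w := (F i w, \big[op/idx]_(j <- s | Q j) F j w).
apply: (@measurableT_comp _ _ _ _ _ _ (fun z => op z.1 z.2) _ g) => //.
exact/measurable_fun_pair.
Qed.

(** The accumulator [inr j] collects the fibre of [pi] over [j]; each induction step merges one
    entry [inl i] into [inr (pi i)]. Uniqueness of [s] guarantees that slot [i] still holds [X i]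
    when its turn comes. *)
Lemma independent_block (I J : finType) (X : I -> T -> R) (pi : I -> J)
    (op : R -> R -> R) (idx : R) (F : I -> R -> R) (s : seq I) :
  measurable_fun [set: R * R] (fun z => op z.1 z.2) ->
  (forall i, measurable_fun [set: R] (F i)) ->
  (forall i, measurable_fun [set: T] (X i)) ->
  uniq s -> mutually_independent P X ->
  mutually_independent P (fun k : I + J => match k with
    | inl i => if i \in s then fun=> 0 else X i
    | inr j => fun w => \big[op/idx]_(i <- s | pi i == j) F i (X i w)
    end).
Proof.
move=> mop mF mX us indX; elim: s us => [_|i s IH /= /andP[nis us]].
  have := @independent_cst _ J _ idx indX; congr mutually_independent.
  by apply/funext => -[i|j] //; apply/funext => w; rewrite big_nil.
have := IH us => /independent_merge.
move=> /(_ (inl i) (inr (pi i)) isT _ (fun x y => op (F i x) y)).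
have -> : (fun k => if k == inl i then fun=> 0 else
    if k == inr (pi i) then fun w => op (F i ((if i \in s then fun=> 0 else X i) w))
       (\big[op/idx]_(i0 <- s | pi i0 == pi i) F i0 (X i0 w))
    else match k with
    | inl i => if i \in s then fun=> 0 else X i
    | inr j => fun w => \big[op/idx]_(i <- s | pi i == j) F i (X i w)
    end) = (fun k : I + J => match k with
    | inl i0 => if i0 \in i :: s then fun=> 0 else X i0
    | inr j => fun w => \big[op/idx]_(i <- i :: s | pi i == j) F i (X i w)
    end).
  apply/funext => -[k|j].
    by rewrite -[inl k == inl i]/(k == i) inE; case: (k == i).
  rewrite -[inr j == inl i]/false -[inr j == inr _]/(j == pi i).
  apply/funext => w; rewrite big_cons (negbTE nis) eq_sym.
  by case: eqP => // ->.
apply.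
- move=> [k|j]; first by case: ifP.
  apply: measurable_big => // k.
  exact: measurableT_comp.
- apply: (@measurableT_comp _ _ _ _ _ _ (fun z => op z.1 z.2) _
    (fun z => (F i z.1, z.2))) => //.
  by apply/measurable_fun_pair => //; exact: measurableT_comp.
Qed.

End independence.

(** * Expectations of products of independent variables *)

Section independent_expectation.
Context {dT : measure_display} {T : measurableType dT} {R : realType}.
Variable P : probability T R.

(** Once [independent_block] has absorbed every index, only the accumulators are kept. *)
Lemma independent_big (I J : finType) (X : I -> T -> R) (pi : I -> J)
    (op : R -> R -> R) (idx : R) (F : I -> R -> R) :
  measurable_fun [set: R * R] (fun z => op z.1 z.2) ->
  (forall i, measurable_fun [set: R] (F i)) ->
  (forall i, measurable_fun [set: T] (X i)) ->
  mutually_independent P X ->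
  mutually_independent P
    (fun j w => \big[op/idx]_(i | pi i == j) F i (X i w)).
Proof.
move=> mop mF mX indX.
have inrI : injective (@inr I J) by move=> ? ? [].
have := @independent_block _ _ _ P I J X pi op idx F _ mop mF mX
  (index_enum_uniq I) indX.
by move=> /(independent_sub inrI).
Qed.

Definition independent2 (U V : T -> R) := forall A B : set R,
  measurable A -> measurable B ->
  P (U @^-1` A `&` V @^-1` B) = (P (U @^-1` A) * P (V @^-1` B))%E.

Lemma mutually_independent2 (I : finType) (X : I -> T -> R) (i j : I) :
  i != j -> mutually_independent P X -> independent2 (X i) (X j).
Proof.
move=> ij indX A B mA mB.
have hI : injective (fun b : bool => if b then i else j).
  by move=> [] [] // /eqP; rewrite ?(negbTE ij)// eq_sym (negbTE ij).
have /independent_bigcap/(_ (fun b : bool => if b then A else B)) :=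
  independent_sub hI indX.
by rewrite !big_bool/=; apply => -[].
Qed.

(** A single accumulator, indexed by [unit], absorbs [s]; slot [i] is untouched because it lies
    outside [s]. *)
Lemma independent2_big (I : finType) (X : I -> T -> R) (F : I -> R -> R)
    (op : R -> R -> R) (idx : R) (i : I) (s : seq I) :
  measurable_fun [set: R * R] (fun z => op z.1 z.2) ->
  (forall i, measurable_fun [set: R] (F i)) ->
  (forall i, measurable_fun [set: T] (X i)) ->
  mutually_independent P X -> i \notin s -> uniq s ->
  independent2 (F i \o X i) (fun w => \big[op/idx]_(k <- s) F k (X k w)).
Proof.
move=> mop mF mX indX nis us.
have := @independent_block _ _ _ P I unit X (fun=> tt) op idx F s mop mF mX us indX.
move=> /(@mutually_independent2 _ _ (inl i) (inr tt)) => /(_ isT).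
rewrite (negbTE nis) => H A B mA mB.
by apply: (H (F i @^-1` A)) => //; exact: measurable_inv.
Qed.

Section pair.
Variables U V : T -> R.
Hypotheses (mU : measurable_fun [set: T] U) (mV : measurable_fun [set: T] V).
Hypothesis UV : independent2 U V.

Let pU : {mfun T >-> R} := HB.pack U (isMeasurableFun.Build _ _ _ _ _ mU).
Let pV : {mfun T >-> R} := HB.pack V (isMeasurableFun.Build _ _ _ _ _ mV).
Let mUV : measurable_fun [set: T] (fun w => (U w, V w)).
Proof. exact/measurable_fun_pair. Qed.

Lemma independent2_joint (S : set (R * R)) : measurable S ->
  P ((fun w => (U w, V w)) @^-1` S) =
  (distribution P pU \x distribution P pV)%E S.
Proof.
move=> mS; pose m := pushforward P (fun w => (U w, V w))
  : {measure set (R * R) -> \bar R}.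
by rewrite (@product_measure_unique _ _ _ _ _ _ _ (m mUV)).
Qed.

(** Tonelli for the joint law, pulled back so that the second variable runs over its own copy of
    [T]. *)
Lemma ge0_integral_independent2 (f : R * R -> \bar R) :
  measurable_fun setT f -> (forall z, 0 <= f z)%E ->
  (\int[P]_w f (U w, V w) =
   \int[P]_w \int[P]_v f (U w, V v))%E.
Proof.
move=> mf f0.
rewrite -(@ge0_integral_pushforward _ _ _ _ _ _ mUV P setT f)//=.
rewrite (eq_measure_integral (distribution P pU \x distribution P pV)%E); last first.
  by move=> A mA _; exact: independent2_joint.
rewrite fubini_tonelli1//.
rewrite ge0_integral_distribution//=; last 2 first.
- exact: measurable_fun_fubini_tonelli_F.
- by move=> x; apply: integral_ge0.
apply: eq_integral => w _; rewrite /fubini_F ge0_integral_distribution//.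
exact: measurableT_comp.
Qed.

Lemma integral_mul_independent2 :
  P.-integrable [set: T] (EFin \o U) -> P.-integrable [set: T] (EFin \o V) ->
  P.-integrable [set: T] (fun w => (U w * V w)%:E) /\
  (\int[P]_w (U w * V w)%:E = \int[P]_w (U w)%:E * \int[P]_w (V w)%:E)%E.
Proof.
move=> iU iV.
pose f (z : R * R) := (z.1 * z.2)%:E.
have mf : measurable_fun setT f.
  by apply/measurable_EFinP; exact: measurable_funM.
have iUV : P.-integrable [set: T] (fun w => (U w * V w)%:E).
  apply/integrableP; split.
    by apply/measurable_EFinP; exact: measurable_funM.
  (* Integrability comes before Fubini: Tonelli evaluates [E |U V|] as [E |U|] times [E |V|], which
     is finite. *)
  rewrite (ge0_integral_independent2 (f := fun z => `|f z|%E))//; last first.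
    exact: measurableT_comp.
  rewrite /f/=; under eq_integral do under eq_integral do rewrite normrM EFinM.
  under eq_integral => w _.
    rewrite ge0_integralZl//; last first.
      by apply/measurable_EFinP; exact: measurableT_comp.
    over.
  rewrite ge0_integralZr//; last 2 first.
  - by apply/measurable_EFinP; exact: measurableT_comp.
  - by apply: integral_ge0 => w _; rewrite lee_fin.
  move/integrableP: iU => [_ iU]; move/integrableP: iV => [_ iV].
  rewrite lte_mul_pinfty//; first by apply: integral_ge0 => w _; rewrite lee_fin.
  by rewrite ge0_fin_numE//; apply: integral_ge0 => w _; rewrite lee_fin.
split=> //.
pose m := pushforward P (fun w => (U w, V w))
  : {measure set (R * R) -> \bar R}.
pose mp := (distribution P pU \x distribution P pV)%E.
have mE A : measurable A -> A `<=` setT -> m mUV A = mp A.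
  by move=> mA _; exact: independent2_joint.
have imf : (m mUV).-integrable setT f by exact: integrable_pushforward.
have ipf : mp.-integrable setT f.
  move/integrableP: imf => [_ imf]; apply/integrableP; split => //.
  by rewrite (eq_measure_integral (m mUV))// => A mA /(mE _ mA)/esym.
transitivity (\int[m mUV]_z f z)%E; first by rewrite integral_pushforward.
rewrite (eq_measure_integral mp)// -integral12_prod_meas1// /fubini_F /f/=.
have EV : (\int[distribution P pV]_y y%:E = \int[P]_w (V w)%:E)%E.
  by rewrite integral_distribution.
have fV : (\int[P]_w (V w)%:E)%E \is a fin_num by exact: integrable_fin_num.
under eq_integral => x _.
  under eq_integral do rewrite EFinM.
  rewrite integralZl//; last exact: integrable_pushforward.
  rewrite EV -(fineK fV).
  over.
rewrite integralZr//; last exact: integrable_pushforward.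
by rewrite integral_distribution// fineK.
Qed.

End pair.

(** One factor is split off at a time. The induction carries integrability along with the value,
    since the two-variable formula requires it of the remaining product. *)
Lemma integral_prod_independent (I : finType) (X : I -> T -> R)
    (F : I -> R -> R) :
  (forall i, measurable_fun [set: R] (F i)) ->
  (forall i, measurable_fun [set: T] (X i)) ->
  mutually_independent P X ->
  (forall i, P.-integrable [set: T] (fun w => (F i (X i w))%:E)) ->
  P.-integrable [set: T] (fun w => (\prod_i F i (X i w))%:E) /\
  (\int[P]_w (\prod_i F i (X i w))%:E = \prod_i \int[P]_w (F i (X i w))%:E)%E.
Proof.
move=> mF mX indX iF.
have := index_enum_uniq I; elim: (index_enum I) => [_|i s IH /=].
  rewrite big_nil; under eq_fun do rewrite big_nil.
  split; first exact: finite_measure_integrable_cst.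
  by rewrite integral_cst// mul1e; exact: probability_setT.
move=> /andP[nis us]; have [iS ES] := IH us.
have mM : measurable_fun [set: R * R] (fun z => z.1 * z.2).
  exact: measurable_funM.
have mZ : measurable_fun [set: T] (fun w => \prod_(k <- s) F k (X k w)).
  by apply: measurable_big => // k; exact: measurableT_comp.
have [] := @integral_mul_independent2 (F i \o X i) _ _ mZ
  (independent2_big 1 mM mF mX indX nis us) (iF i) iS.
  exact: measurableT_comp.
rewrite ES => ? E; split.
  by under eq_fun do rewrite big_cons.
by rewrite big_cons -E; under eq_integral do rewrite big_cons.
Qed.

End independent_expectation.

(** * Gaussian integrals *)

Section gaussian_integrals.
Context {R : realType}.
Local Notation mu := (@lebesgue_measure R).

Lemma lebesgue_measure_affine (c b : R) (A : set (measurableTypeR R)) : c != 0 -> measurable A ->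
  mu A = (`|c|%:E * mu ((fun x => (c * x + b)%R) @^-1` A))%E.
Proof.
move=> c0 mA.
have mf : measurable_fun [set: measurableTypeR R]
    (fun x => c * x + b : measurableTypeR R).
  by apply: measurable_funD => //; exact: measurable_funM.
pose m := pushforward mu (fun x => c * x + b : measurableTypeR R)
  : {measure set (measurableTypeR R) -> \bar R}.
pose nc : {nonneg R} := NngNum (normr_ge0 c).
apply: (@lebesgue_measure_unique _ (mscale nc (m mf))) => // X [[u v] _ <-].
rewrite lebesgue_measure_itv/= /mscale/= /pushforward/= lte_fin.
have [c_gt0|c_lt0|] := ltgtP 0 c; last by move/eqP; rewrite eq_sym (negbTE c0).
- rewrite (_ : _ @^-1` _ = `](u - b) / c, (v - b) / c]%classic); last first.
    apply/seteqP; split => x /=; rewrite !in_itv/=;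
    by rewrite ltr_pdivrMr// ler_pdivlMr// ltrBlDr lerBrDr [x * c]mulrC.
  rewrite lebesgue_measure_itv/= lte_fin ltr_pM2r ?invr_gt0// ltrD2r.
  case: ifPn => _; last by rewrite mule0.
  rewrite -!EFinB -EFinM; congr (_%:E).
  by rewrite gtr0_norm//; field.
(* A negative slope swaps the endpoints and the closed side of the interval, but not the formula for
   its length. *)
- rewrite (_ : _ @^-1` _ = `[(v - b) / c, (u - b) / c[%classic); last first.
    apply/seteqP; split => x /=; rewrite !in_itv/=;
    by rewrite ltr_ndivlMr// ler_ndivrMr// ltrBlDr lerBrDr [x * c]mulrC andbC.
  rewrite lebesgue_measure_itv/= lte_fin ltr_nM2r ?invr_lt0// ltrD2r.
  case: ifPn => _; last by rewrite mule0.
  rewrite -!EFinB -EFinM; congr (_%:E).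
  by rewrite ltr0_norm//; field.
Qed.

Lemma ge0_integral_affine (c b : R) (f : R -> \bar R) : c != 0 ->
  measurable_fun [set: R] f -> (forall x, 0 <= f x)%E ->
  (\int[mu]_x f x = `|c|%:E * \int[mu]_x f (c * x + b)%R)%E.
Proof.
move=> c0 mf f0.
have maff : measurable_fun [set: measurableTypeR R]
    (fun x => c * x + b : measurableTypeR R).
  by apply: measurable_funD => //; exact: measurable_funM.
pose m := pushforward mu (fun x => c * x + b : measurableTypeR R)
  : {measure set (measurableTypeR R) -> \bar R}.
pose nc : {nonneg R} := NngNum (normr_ge0 c).
rewrite (eq_measure_integral (mscale nc (m maff)))/=; last first.
  by move=> A mA _; rewrite (@lebesgue_measure_affine c b).
rewrite ge0_integral_mscale//=; congr (_ * _)%E.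
by rewrite ge0_integral_pushforward.
Qed.

(** Change of variables holds for the Radon-Nikodym derivative, which equals [normal_pdf] almost
    everywhere because both integrate to [normal_prob m s] over every measurable set. *)
Lemma ge0_integral_normal_prob (m s : R) (f : R -> \bar R) :
  measurable_fun [set: R] f -> (forall x, 0 <= f x)%E ->
  (\int[normal_prob m s]_x f x = \int[mu]_x (f x * (normal_pdf m s x)%:E))%E.
Proof.
move=> mf f0.
have dom := @normal_prob_dominates R m s.
rewrite -(Radon_Nikodym_SigmaFinite.change_of_variables dom)//.
have mpdf : measurable_fun setT (fun x => (normal_pdf m s x)%:E).
  by apply/measurable_EFinP; exact: measurable_normal_pdf.
apply: ae_eq_integral => //.
- apply: emeasurable_funM => //; apply: (measurable_int mu).
  exact: Radon_Nikodym_SigmaFinite.f_integrable.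
- exact: emeasurable_funM.
- apply: ae_eqe_mul2l; apply: integral_ae_eq => //.
  + exact: Radon_Nikodym_SigmaFinite.f_integrable.
  + by move=> A _ mA; rewrite -Radon_Nikodym_SigmaFinite.f_integral.
Qed.

(** With [s] outside the square root, [Num.sqrt (pi *+ 2)] is an opaque nonzero constant and
    identities between densities are within reach of [field]. *)
Lemma normal_pdf_gt0E (m s x : R) : 0 < s -> normal_pdf m s x =
  (s * Num.sqrt (pi *+ 2))^-1 * expR (- ((x - m) ^+ 2 / (s ^+ 2 *+ 2))).
Proof.
move=> s0; rewrite normal_pdfE ?gt_eqF// /normal_peak /normal_fun mulNr.
by rewrite -mulrnAr sqrtrM ?sqr_ge0// sqrtr_sqr gtr0_norm.
Qed.

Let sqrt2pi_neq0 : Num.sqrt (pi *+ 2) != 0 :> R.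
Proof. by rewrite gt_eqF// sqrtr_gt0 pmulrn_lgt0// pi_gt0. Qed.

Lemma normal_pdf_scale (c s x : R) : c != 0 -> 0 < s ->
  normal_pdf 0 s x = `|c| * normal_pdf 0 (`|c| * s) (c * x).
Proof.
move=> c0 s0; have nc0 : 0 < `|c| by rewrite normr_gt0.
rewrite !normal_pdf_gt0E ?mulr_gt0//.
rewrite !subr0.
have -> : (c * x) ^+ 2 / ((`|c| * s) ^+ 2 *+ 2) = x ^+ 2 / (s ^+ 2 *+ 2).
  by rewrite !exprMn real_normK ?num_real//; field; rewrite c0 gt_eqF.
by field; rewrite sqrt2pi_neq0 (gt_eqF nc0) (gt_eqF s0).
Qed.

Lemma normal_prob_scale (c s : R) (A : set R) : c != 0 -> 0 < s ->
  measurable A ->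
  normal_prob 0 s ((fun x => c * x) @^-1` A) = normal_prob 0 (`|c| * s) A.
Proof.
move=> c0 s0 mA.
have mcA : measurable ((fun x : R => c * x) @^-1` A).
  by rewrite -[X in measurable X]setTI; apply: measurable_funM.
have mpdf (s' : R) : measurable_fun setT (fun x => (normal_pdf 0 s' x)%:E).
  by apply/measurable_EFinP; exact: measurable_normal_pdf.
have E (s' : R) B : measurable B -> normal_prob 0 s' B =
    (\int[mu]_x ((\1_B x)%:E * (normal_pdf 0 s' x)%:E))%E.
  move=> mB; rewrite -ge0_integral_normal_prob//.
    by rewrite integral_indic// setIT.
  exact/measurable_EFinP.
pose g (x : R) : \bar R := ((\1_A x)%:E * (normal_pdf 0 (`|c| * s) x)%:E)%E.
have mg : measurable_fun setT g.
  by apply: emeasurable_funM; [exact/measurable_EFinP|exact: mpdf].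
have g0 x : (0 <= g x)%E by rewrite mule_ge0// lee_fin normal_pdf_ge0.
transitivity (\int[mu]_x g x)%E; last exact/esym/E.
rewrite (E _ _ mcA) (ge0_integral_affine 0 c0 mg g0).
have mc : measurable_fun [set: R] (fun x => c * x + 0).
  by apply: measurable_funD => //; exact: measurable_funM.
rewrite -ge0_integralZl//; last exact: measurableT_comp.
apply: eq_integral => x _; rewrite addr0 (normal_pdf_scale x c0 s0) /g.
by rewrite -!EFinM !indicE/= mulrCA.
Qed.

(** Completing the square in [x]: the joint density of a summand and the sum is the density of the
    sum at [z] times the conditional density of the summand, of mean [z * s ^+ 2 / q ^+ 2] and
    standard deviation [s * t / q]. *)
Lemma normal_pdf_mul (s t x z : R) : 0 < s -> 0 < t ->
  let q := Num.sqrt (s ^+ 2 + t ^+ 2) in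
  normal_pdf 0 s x * normal_pdf 0 t (z - x) =
  normal_pdf 0 q z * normal_pdf (z * s ^+ 2 / q ^+ 2) (s * t / q) x.
Proof.
move=> s0 t0 q.
have s20 : 0 < s ^+ 2 by rewrite exprn_gt0.
have t20 : 0 < t ^+ 2 by rewrite exprn_gt0.
have st0 : 0 < s ^+ 2 + t ^+ 2 by rewrite addr_gt0.
have q0 : 0 < q by rewrite sqrtr_gt0.
have q2 : q ^+ 2 = s ^+ 2 + t ^+ 2 by rewrite sqr_sqrtr// ltW.
rewrite !normal_pdf_gt0E// ?divr_gt0 ?mulr_gt0//.
have k0 := sqrt2pi_neq0; move: (Num.sqrt (pi *+ 2)) k0 => k k0.
have [sn tn qn] : [/\ s != 0, t != 0 & q != 0] by rewrite !gt_eqF.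
have q2n : s ^+ 2 + t ^+ 2 != 0 by rewrite gt_eqF.
rewrite mulrACA [RHS]mulrACA -!expRD; congr (_ * expR _).
  by field; rewrite sn tn qn k0.
rewrite !expr_div_n q2 !exprMn; clearbody q.
by field; rewrite sn tn q2n.
Qed.

(** In the variables [x] and [z = x + y], Tonelli puts the integral over [x] inside, where by
    [normal_pdf_mul] a conditional density integrates to 1. *)
Lemma normal_prob_convolution (s t : R) (A : set R) : 0 < s -> 0 < t ->
  measurable A ->
  (\int[normal_prob 0 s]_x normal_prob 0 t ((fun y => (x + y)%R) @^-1` A))%E =
  normal_prob 0 (Num.sqrt (s ^+ 2 + t ^+ 2)) A.
Proof.
move=> s0 t0 mA; set q := Num.sqrt _.
have mpdf (m s' : R) : measurable_fun setT (fun x => (normal_pdf m s' x)%:E).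
  by apply/measurable_EFinP; exact: measurable_normal_pdf.
have m1A : measurable_fun setT (fun x : R => (\1_A x)%:E : \bar R).
  exact/measurable_EFinP.
have E (s' : R) B : measurable B -> normal_prob 0 s' B =
    (\int[mu]_x ((\1_B x)%:E * (normal_pdf 0 s' x)%:E))%E.
  move=> mB; rewrite -ge0_integral_normal_prob//.
    by rewrite integral_indic// setIT.
  exact/measurable_EFinP.
have mx x : measurable ((fun y : R => x + y) @^-1` A).
  by rewrite -[X in measurable X]setTI; apply: measurable_funD.
pose f (z : R * R) : \bar R := ((\1_A z.2)%:E * (normal_pdf 0 t (z.2 - z.1))%:E)%E.
have mf : measurable_fun setT f.
  apply: emeasurable_funM; first exact: (measurableT_comp m1A).
  have mB : measurable_fun setT (fun z : R * R => z.2 - z.1).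
    exact: measurable_funB.
  exact: (measurableT_comp (mpdf 0 t) mB).
have f0 z : (0 <= f z)%E by rewrite mule_ge0// lee_fin// normal_pdf_ge0.
have Ex x : normal_prob 0 t ((fun y => x + y) @^-1` A) = (\int[mu]_z f (x, z))%E.
  rewrite (E _ _ (mx x)) (@ge0_integral_affine 1 x (fun z => f (x, z)))//; last first.
    exact: measurableT_comp.
  rewrite normr1 mul1e; apply: eq_integral => y _.
  by rewrite /f/= mul1r addrK !indicE/= addrC.
under eq_integral do rewrite Ex.
rewrite ge0_integral_normal_prob//; last 2 first.
- exact: measurable_fun_fubini_tonelli_F.
- by move=> x; apply: integral_ge0.
under eq_integral => x _.
  rewrite -ge0_integralZr//; last 2 first.
  + exact: measurableT_comp.
  + by rewrite lee_fin normal_pdf_ge0.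
  over.
pose g (z : R * R) : \bar R := (f z * (normal_pdf 0 s z.1)%:E)%E.
have mg : measurable_fun setT g.
  apply: emeasurable_funM => //.
  exact: (measurableT_comp (mpdf 0 s) measurable_fst).
have g0 z : (0 <= g z)%E by rewrite mule_ge0// lee_fin normal_pdf_ge0.
rewrite -[LHS]/(\int[mu]_x \int[mu]_z g (x, z))%E.
rewrite (@fubini_tonelli _ _ _ _ _ mu mu g mg g0) (E _ _ mA).
apply: eq_integral => z _.
have gE x : g (x, z) = ((\1_A z * normal_pdf 0 q z)%:E *
    (normal_pdf (z * s ^+ 2 / q ^+ 2) (s * t / q) x)%:E)%E.
  rewrite /g /f/= -!EFinM; congr (_%:E).
  rewrite -[LHS]mulrA -[RHS]mulrA; congr (_ * _).
  by rewrite [LHS]mulrC; exact: normal_pdf_mul.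
under eq_integral do rewrite gE.
rewrite -EFinM.
rewrite ge0_integralZl//; last 3 first.
- exact: mpdf.
- by move=> x _; rewrite lee_fin normal_pdf_ge0.
- by rewrite lee_fin mulr_ge0// normal_pdf_ge0.
by rewrite integral_normal_pdf mule1.
Qed.

End gaussian_integrals.

(** * Second moment of the centered normal law *)

Section gaussian_moments.
Context {R : realType}.
Local Notation mu := (@lebesgue_measure R).
Variable s : R.
Hypothesis s0 : 0 < s.

(** This is [t] times the ratio of the centered normal densities of standard deviations [t * s] and
    [s], so its integral is [t] at once. *)
Let expq (t x : R) := expR ((1 - t ^- 2) / (s ^+ 2 *+ 2) * x ^+ 2).

Let measurable_expq t : measurable_fun [set: R] (fun x => (expq t x)%:E).
Proof.
apply/measurable_EFinP; apply: measurableT_comp => //.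
by apply: measurable_funM => //; exact: measurable_funX.
Qed.

Let integral_expq (t : R) : 0 < t ->
  (\int[normal_prob 0 s]_x (expq t x)%:E = t%:E)%E.
Proof.
move=> t0; rewrite ge0_integral_normal_prob//; last first.
  by move=> x; rewrite lee_fin expR_ge0.
have k0 : Num.sqrt (pi *+ 2) != 0 :> R.
  by rewrite gt_eqF// sqrtr_gt0 pmulrn_lgt0// pi_gt0.
have E x : ((expq t x)%:E * (normal_pdf 0 s x)%:E =
    t%:E * (normal_pdf 0 (t * s) x)%:E)%E.
  rewrite -!EFinM !normal_pdf_gt0E ?mulr_gt0//; congr (_%:E).
  rewrite mulrCA /expq -expRD [RHS]mulrA; congr (_ * expR _).
    by move: (Num.sqrt _) k0 => k k0; field; rewrite k0 !gt_eqF.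
  by rewrite !subr0; field; rewrite !gt_eqF.
under eq_integral do rewrite E.
rewrite ge0_integralZl//; last 3 first.
- by apply/measurable_EFinP; exact: measurable_normal_pdf.
- by move=> x _; rewrite lee_fin normal_pdf_ge0.
- by rewrite lee_fin ltW.
by rewrite integral_normal_pdf mule1.
Qed.

Let integrable_expq (t : R) : 0 < t ->
  (normal_prob 0 s).-integrable [set: R] (fun x => (expq t x)%:E).
Proof.
move=> t0; apply/integrableP; split; first exact: measurable_expq.
under eq_integral do rewrite /= ger0_norm ?expR_ge0//.
by rewrite integral_expq// ltry.
Qed.

(** At [t = 2] the exponent of [expq] is [x ^+ 2 / c] with [c > 0], and [y <= expR y] dominates
    [x ^+ 2] by [c * expq 2 x]. *)
Lemma integrable_normal_sqr :
  (normal_prob 0 s).-integrable [set: R] (fun x => (x ^+ 2)%:E).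
Proof.
have t0 : 0 < 2 :> R by [].
pose c := s ^+ 2 *+ 2 / (1 - 2 ^- 2).
have c0 : 0 < c by rewrite divr_gt0 ?pmulrn_lgt0 ?exprn_gt0//; lra.
have cV : c^-1 = (1 - 2 ^- 2) / (s ^+ 2 *+ 2) by rewrite /c invf_div.
clearbody c.
have := @le_integrable _ _ _ (normal_prob 0 s) setT measurableT
  (fun x => (x ^+ 2)%:E) (fun x => c%:E * (expq 2 x)%:E)%E.
apply => //.
- by apply/measurable_EFinP; exact: measurable_funX.
- move=> x _; rewrite /= lee_fin ger0_norm ?sqr_ge0//.
  rewrite ger0_norm; last by rewrite mulr_ge0 ?expR_ge0 ?(ltW c0).
  rewrite -ler_pdivrMl//; apply: le_trans (expR_ge1Dx _).
  by rewrite cV lerDr.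
- exact: integrableZl (integrable_expq t0).
Qed.

(* [1 + y <= expR y] at [y = (1 - t^-2) x^2 / (2 s^2)] integrates to
   [1 + (1 - t^-2) M / (2 s^2) <= t] for every [t > 0], where [M] is the second
   moment; at [t = sqrt M / s] this reads [(t - 1)^2 <= 0]. *)
Lemma integral_normal_sqr :
  (\int[normal_prob 0 s]_x (x ^+ 2)%:E = (s ^+ 2)%:E)%E.
Proof.
have iX := integrable_normal_sqr.
set M := (\int[_]_x _)%E.
have fM : M \is a fin_num by exact: integrable_fin_num.
rewrite -(fineK fM); set m := fine M; congr (_%:E).
have s20 : 0 < s ^+ 2 by rewrite exprn_gt0.
have H (t : R) : 0 < t -> (1 - t ^- 2) * m <= s ^+ 2 *+ 2 * (t - 1).
  move=> t0; pose h := (1 - t ^- 2) / (s ^+ 2 *+ 2).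
  have i1 : (normal_prob 0 s).-integrable [set: R] (fun=> 1%E).
    exact: finite_measure_integrable_cst.
  have ihX : (normal_prob 0 s).-integrable [set: R] (fun x => h%:E * (x ^+ 2)%:E)%E.
    exact: integrableZl.
  have : (\int[normal_prob 0 s]_x (1 + h%:E * (x ^+ 2)%:E) <=
      \int[normal_prob 0 s]_x (expq t x)%:E)%E.
    apply: le_integral => //.
    - exact: integrableD.
    - exact: integrable_expq.
    - by move=> x _; rewrite -EFinM -EFinD lee_fin; exact: expR_ge1Dx.
  have c1 : (\int[normal_prob 0 s]_x 1 = 1%:E)%E.
    by rewrite integral_cst// mul1e; exact: probability_setT.
  rewrite integral_expq// integralD// integralZl// c1 -/M -(fineK fM) -/m.
  rewrite -EFinM -EFinD lee_fin -lerBrDl /h mulrAC ler_pdivrMr ?pmulrn_lgt0//.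
  by rewrite [leRHS]mulrC.
(* At [t = 1/2] the bound reads [-3 m <= - s^2]. Positivity of [m] makes [t = sqrt m / s]
   admissible. *)
have m0 : 0 < m.
  have := H 2^-1; rewrite invr_gt0 => /(_ (ltr0n _ 2)); rewrite exprVn invrK; lra.
have r0 : 0 < Num.sqrt m by rewrite sqrtr_gt0.
have := H (Num.sqrt m / s) (divr_gt0 r0 s0).
rewrite -{2 4}(sqr_sqrtr (ltW m0)); move: (Num.sqrt m) r0 => r r0.
rewrite expr_div_n invf_div mulrBl mul1r divfK ?gt_eqF ?exprn_gt0// => {}H.
have : (r - s) ^+ 2 <= 0.
  apply: le_trans (_ : r ^+ 2 - s ^+ 2 - (s ^+ 2 *+ 2 * (r / s - 1)) <= 0).
    by rewrite le_eqVlt; apply/orP; left; apply/eqP; field; rewrite gt_eqF.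
  by rewrite subr_le0.
by rewrite real_exprn_even_le0 ?num_real//= subr_eq0 => /eqP->.
Qed.

End gaussian_moments.

(* The centered normal law of variance [v]; [normal_prob 0 0] is not a Dirac
   mass in the library, whence the case split. *)
Definition normal_law {R : realType} (v : R) :
    {measure set (measurableTypeR R) -> \bar R} :=
  if v == 0 then (dirac (0 : measurableTypeR R) : {measure set _ -> \bar R})
  else (normal_prob 0 (Num.sqrt v) : {measure set _ -> \bar R}).

(** The parameter is the variance, unlike the standard deviation in [gaussian_rv]: variances add,
    scale by [c ^+ 2], and may be 0. *)
Definition has_normal_law {dT : measure_display} {T : measurableType dT}
    {R : realType} (P : probability T R) (v : R) (X : T -> R) :=
  measurable_fun [set: T] X /\
  forall A : set R, measurable A -> P (X @^-1` A) = normal_law v A.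

(** * Scaling and addition of centered normal variables *)

Section normal_law.
Context {dT : measure_display} {T : measurableType dT} {R : realType}.
Variable P : probability T R.

Lemma gaussian_rv_normal_law (s : R) (X : T -> R) :
  0 < s -> gaussian_rv P s X -> has_normal_law P (s ^+ 2) X.
Proof.
move=> s0 [mX XE]; split=> // A mA; rewrite XE// /normal_law.
by rewrite expf_eq0/= (gt_eqF s0) sqrtr_sqr (gtr0_norm s0).
Qed.

Lemma integral_normal_law_gauss (v : R) (f : R -> R) :
  measurable_fun [set: R] f ->
  (\int[normal_law v]_x (f x)%:E)%E = gauss_expect v f.
Proof.
move=> mf; rewrite /normal_law /gauss_expect; case: ifP => // _.
by rewrite integral_dirac// ?diracT ?mul1e//; exact/measurable_EFinP.
Qed.

Lemma ge0_integral_has_normal_law (v : R) (X : T -> R) (f : R -> \bar R) :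
  has_normal_law P v X -> measurable_fun [set: R] f -> (forall x, 0 <= f x)%E ->
  (\int[P]_w f (X w) = \int[normal_law v]_x f x)%E.
Proof.
move=> [mX XE] mf f0.
have mX' : measurable_fun [set: T] (X : T -> measurableTypeR R) by exact: mX.
pose m := pushforward P (X : T -> measurableTypeR R)
  : {measure set (measurableTypeR R) -> \bar R}.
transitivity (\int[m mX']_x f x)%E.
  by rewrite ge0_integral_pushforward.
by apply: eq_measure_integral => A mA _; exact: XE.
Qed.

Lemma has_normal_law_cst0 : has_normal_law P 0 (fun=> 0).
Proof.
split=> // A mA; by rewrite probability_preimage_cst /normal_law eqxx.
Qed.

Lemma has_normal_law_scale (c v : R) (X : T -> R) : 0 <= v ->
  has_normal_law P v X -> has_normal_law P (c ^+ 2 * v) (fun w => c * X w).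
Proof.
move=> v0 [mX XE]; have [->|c0] := eqVneq c 0.
  rewrite expr0n mul0r; under eq_fun do rewrite mul0r.
  exact: has_normal_law_cst0.
split; first exact: measurable_funM.
move=> A mA.
have mc : measurable_fun [set: R] (fun x => c * x) by exact: measurable_funM.
rewrite (XE ((fun x => c * x) @^-1` A)); last first.
  by rewrite -[X in measurable X]setTI; exact: mc.
rewrite /normal_law mulf_eq0 expf_eq0/= (negbTE c0)/=.
have [_|vn0] := eqVneq v 0.
  rewrite [LHS]diracE [RHS]diracE; congr ((nat_of_bool _)%:R%:E).
  by rewrite -[LHS]/(c * 0 \in A) mulr0.
have -> : Num.sqrt (c ^+ 2 * v) = `|c| * Num.sqrt v.
  by rewrite sqrtrM ?sqr_ge0// sqrtr_sqr.
apply: normal_prob_scale => //.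
by rewrite sqrtr_gt0 lt_neqAle eq_sym vn0.
Qed.

(** Given [U = x] the sum is [V] translated by [x]; averaging over [U] leaves a convolution. Zero
    variances are treated apart, as the computation with densities requires both to be positive. *)
Lemma has_normal_law_add (u v : R) (U V : T -> R) : 0 <= u -> 0 <= v ->
  independent2 P U V -> has_normal_law P u U -> has_normal_law P v V ->
  has_normal_law P (u + v) (fun w => U w + V w).
Proof.
move=> u0 v0 UV nU nV; have [[mU UE] [mV VE]] := (nU, nV).
split; first exact: measurable_funD.
move=> A mA.
have mUV : measurable_fun [set: T] (fun w => U w + V w) by exact: measurable_funD.
have madd : measurable_fun [set: R * R] (fun z : R * R => z.1 + z.2).
  exact: measurable_funD.
have mf : measurable_fun setT (fun z : R * R => (\1_A (z.1 + z.2))%:E : \bar R).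
  by apply/measurable_EFinP; exact: (measurableT_comp _ madd).
have mx x : measurable ((fun y : R => x + y) @^-1` A).
  by rewrite -[X in measurable X]setTI; apply: measurable_funD.
pose pV : {mfun T >-> R} := HB.pack V (isMeasurableFun.Build _ _ _ _ _ mV).
have mfx x : measurable_fun [set: R] (fun y : R => (\1_A (x + y))%:E : \bar R).
  apply/measurable_EFinP; apply: measurableT_comp => //.
  exact: measurable_funD.
pose g x := P (V @^-1` ((fun y => x + y) @^-1` A)).
have gE x : (g x = \int[distribution P pV]_y (\1_A (x + y))%:E)%E.
  rewrite ge0_integral_distribution//.
  rewrite /g -[X in P X]setIT -integral_indic//.
  by apply: measurable_inv.
(* Measurability of [g] is that of a partial integral in Tonelli's theorem, once [g] is read as an
   integral over the law of [V]. *)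
have mg : measurable_fun [set: R] g.
  have -> : g = fun x => (\int[distribution P pV]_y (\1_A (x + y))%:E)%E.
    exact/funext.
  have f0 (z : R * R) : (0 <= (\1_A (z.1 + z.2))%:E :> \bar R)%E by rewrite lee_fin.
  exact: (@measurable_fun_fubini_tonelli_F _ _ _ _ _ (distribution P pV) _ mf f0).
have g0 x : (0 <= g x)%E by exact: measure_ge0.
have PE : (P ((fun w => (U w + V w)%R) @^-1` A) = \int[normal_law u]_x g x)%E.
  rewrite -(ge0_integral_has_normal_law nU mg g0).
  rewrite -[X in P X]setIT -integral_indic//; last exact: measurable_inv.
  rewrite (ge0_integral_independent2 mU mV UV mf)//.
  apply: eq_integral => w _; rewrite gE ge0_integral_distribution//.
rewrite {}PE /normal_law; have [->|un0] := eqVneq u 0.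
  rewrite integral_dirac//= diracT mul1e add0r /g.
  have -> : (fun y => 0 + y) @^-1` A = A by under eq_fun do rewrite add0r.
  by rewrite VE.
have u_gt0 : 0 < Num.sqrt u by rewrite sqrtr_gt0 lt_neqAle eq_sym un0.
have uv : u + v != 0.
  by rewrite gt_eqF// ltr_wpDr// -sqrtr_gt0.
rewrite (negbTE uv).
under eq_integral do rewrite /g VE// /normal_law.
have [->|vn0] := eqVneq v 0.
  rewrite addr0; transitivity (\int[normal_prob 0 (Num.sqrt u)]_x (\1_A x)%:E)%E;
    last by rewrite integral_indic// setIT.
  apply: eq_integral => x _.
  rewrite [LHS]diracE indicE; congr ((nat_of_bool _)%:R%:E).
  by rewrite -[LHS]/(x + 0 \in A) addr0.
have v_gt0 : 0 < Num.sqrt v by rewrite sqrtr_gt0 lt_neqAle eq_sym vn0.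
have -> : u + v = Num.sqrt u ^+ 2 + Num.sqrt v ^+ 2 by rewrite !sqr_sqrtr.
exact: normal_prob_convolution.
Qed.

End normal_law.

(** * Sums and moments of normal variables *)

Section normal_moments.
Context {dT : measure_display} {T : measurableType dT} {R : realType}.
Variable P : probability T R.

Lemma has_normal_law_sum (I : finType) (X : I -> T -> R) (v : I -> R) :
  (forall i, 0 <= v i) -> mutually_independent P X ->
  (forall i, has_normal_law P (v i) (X i)) ->
  has_normal_law P (\sum_i v i) (fun w => \sum_i X i w).
Proof.
move=> v0 indX nX.
have := index_enum_uniq I; elim: (index_enum I) => [_|i s IH /=].
  rewrite big_nil (_ : (fun w => _) = fun=> 0); last first.
    by apply/funext => w; rewrite big_nil.
  exact: has_normal_law_cst0.
move=> /andP[nis us]; rewrite big_cons.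
rewrite (_ : (fun w => _) = fun w => X i w + \sum_(j <- s) X j w); last first.
  by apply/funext => w; rewrite big_cons.
apply: has_normal_law_add => //; last exact: IH.
- exact: sumr_ge0.
- have mD : measurable_fun [set: R * R] (fun z => z.1 + z.2).
    exact: measurable_funD.
  exact: (@independent2_big _ _ _ P I X (fun=> id) +%R 0 i s mD _
    (fun i => (nX i).1) indX nis us).
Qed.

Lemma integral_normal_law_sqr (v : R) : 0 <= v ->
  (\int[normal_law v]_x (x ^+ 2)%:E = v%:E)%E.
Proof.
move=> v0; rewrite /normal_law; have [->|vn0] := eqVneq v 0.
  rewrite integral_dirac// ?diracT ?mul1e ?expr0n//.
  by apply/measurable_EFinP; exact: measurable_funX.
rewrite -[in RHS](sqr_sqrtr v0); apply: integral_normal_sqr.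
by rewrite sqrtr_gt0 lt_neqAle eq_sym vn0.
Qed.

Section law.
Variables (v : R) (X : T -> R).
Hypotheses (v0 : 0 <= v) (nX : has_normal_law P v X).

Lemma integral_sqr_has_normal_law : (\int[P]_w ((X w) ^+ 2)%:E = v%:E)%E.
Proof.
rewrite -(integral_normal_law_sqr v0).
apply: (ge0_integral_has_normal_law (f := fun x => (x ^+ 2)%:E) nX).
  by apply/measurable_EFinP; exact: measurable_funX.
by move=> x; rewrite lee_fin sqr_ge0.
Qed.

Lemma integrable_sqr_has_normal_law :
  P.-integrable [set: T] (fun w => ((X w) ^+ 2)%:E).
Proof.
apply/integrableP; split.
  by apply/measurable_EFinP; apply: measurable_funX; exact: nX.1.
under eq_integral do rewrite /= ger0_norm ?sqr_ge0//.
by rewrite integral_sqr_has_normal_law ltry.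
Qed.

Lemma integrable_of_sqr (Y : T -> R) : measurable_fun [set: T] Y ->
  P.-integrable [set: T] (fun w => ((Y w) ^+ 2)%:E) ->
  P.-integrable [set: T] (fun w => (Y w)%:E).
Proof.
move=> mY iY2.
have i1 : P.-integrable [set: T] (fun=> 1%E).
  exact: finite_measure_integrable_cst.
have := @le_integrable _ _ _ P setT measurableT
  (fun w => (Y w)%:E) (fun w => 1 + ((Y w) ^+ 2)%:E)%E.
apply; first exact/measurable_EFinP.
  move=> w _; rewrite -EFinD /= lee_fin [leRHS]ger0_norm ?addr_ge0 ?sqr_ge0//.
  rewrite -(real_normK (num_real (Y w))).
  by have := sqr_ge0 (`|Y w| - 1); have := normr_ge0 (Y w); nra.
exact: integrableD.
Qed.

(** Symmetry: [X] and [- X] have the same law, so the positive and negative parts have equal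
    integrals, finite by the second moment. *)
Lemma integral_has_normal_law : (\int[P]_w (X w)%:E = 0)%E.
Proof.
have iX := integrable_of_sqr nX.1 integrable_sqr_has_normal_law.
have nN := has_normal_law_scale (-1) v0 nX.
rewrite sqrrN expr1n mul1r in nN.
pose f (x : R) := (Num.max x 0)%:E : \bar R.
have mf : measurable_fun [set: R] f.
  by apply/measurable_EFinP; exact: measurable_maxr.
have f0 x : (0 <= f x)%E by rewrite lee_fin le_max lexx orbT.
have E : (\int[P]_w f (X w) = \int[P]_w f (-1 * X w)%R)%E.
  by rewrite (ge0_integral_has_normal_law nX mf f0) (ge0_integral_has_normal_law nN mf f0).
rewrite integralE.
have -> : (\int[P]_w ((fun w => (X w)%:E)^\+ w) = \int[P]_w f (X w))%E.
  by apply: eq_integral => w _; rewrite /f funeposE EFin_max.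
have -> : (\int[P]_w ((fun w => (X w)%:E)^\- w) = \int[P]_w f (X w))%E.
  by rewrite E; apply: eq_integral => w _; rewrite /f funenegE EFin_max mulN1r.
apply: subee.
have := integrable_fin_num measurableT (integrable_funepos measurableT iX).
by under eq_integral do rewrite funeposE -EFin_max.
Qed.
End law.

End normal_moments.

(** * Projections of random vectors *)

Section projector.
Context {R : realType} {d : nat}.
Variable Q : 'M[R]_d.
Hypothesis pQ : orth_projector Q.

(** In the rank factorization [Q = C R], idempotence reads [C R C R = C R]; cancelling the full-rank
    factors gives [R C = 1], of size [\rank Q], and [C R] has the same trace. *)
Lemma mxtrace_projector : \tr Q = (\rank Q)%:R.
Proof.
have [_ QQ] := pQ.
have RC : row_base Q *m col_base Q = 1%:M.
  apply: (row_free_inj (row_base_free Q)); rewrite mul1mx.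
  apply: (row_full_inj (col_base_full Q)).
  rewrite -[row_base Q *m _ *m _]mulmxA (mulmx_base Q) [LHS]mulmxA.
  by rewrite (mulmx_base Q).
by rewrite -(congr1 mxtrace (mulmx_base Q)) mxtrace_mulC RC mxtrace1.
Qed.

Lemma sum_sqr_projector : \sum_i \sum_j Q i j ^+ 2 = (\rank Q)%:R.
Proof.
have [QT QQ] := pQ; rewrite -mxtrace_projector -(congr1 mxtrace QQ) /mxtrace.
apply: eq_bigr => i _; rewrite mxE; apply: eq_bigr => j _.
by rewrite expr2; congr (_ * _); rewrite -[in LHS]QT mxE.
Qed.

End projector.

Section random_projection.
Context {dT : measure_display} {T : measurableType dT} {R : realType}.
Variables (P : probability T R) (d m : nat) (tau v : R) (Q : 'M[R]_d).
Variables (h : 'I_m -> T -> R) (W : 'I_d * 'I_m -> T -> R).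

Let X (k : 'I_m + 'I_d * 'I_m) : T -> R :=
  match k with inl l => h l | inr a => W a end.

Hypothesis indX : mutually_independent P X.
Hypothesis nW : forall a, has_normal_law P (tau ^+ 2) (W a).
Hypothesis mh : forall l, measurable_fun [set: T] (h l).
Hypothesis ih : forall l, P.-integrable [set: T] (fun w => ((h l w) ^+ 2)%:E).
Hypothesis Eh : forall l, (\int[P]_w ((h l w) ^+ 2)%:E = v%:E)%E.

Let mX k : measurable_fun [set: T] (X k).
Proof. by case: k => [l|a]; [exact: mh|exact: (nW a).1]. Qed.

Let iX2 k : P.-integrable [set: T] (fun w => ((X k w) ^+ 2)%:E).
Proof.
case: k => [l|a]; first exact: ih.
exact: (integrable_sqr_has_normal_law (sqr_ge0 _) (nW a)).
Qed.

Let iX (k : 'I_m + 'I_d * 'I_m) (n : nat) : (n <= 2)%N ->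
  P.-integrable [set: T] (fun w => ((X k w) ^+ n)%:E).
Proof.
case: n => [|[|[|//]]] _; last exact: iX2.
  exact: finite_measure_integrable_cst.
exact: (integrable_of_sqr (mX k) (iX2 k)).
Qed.

(** Exponents of the monomial attached to [a] and [b]. Counting coincidences treats squares and
    cross terms uniformly. *)
Let deg (a b : 'I_d * 'I_m) (k : 'I_m + 'I_d * 'I_m) : nat :=
  match k with
  | inl l => (l == a.2) + (l == b.2)
  | inr c => (c == a) + (c == b)
  end.

Let monomial_prod a b w :
  W a w * W b w * (h a.2 w * h b.2 w) = \prod_k X k w ^+ deg a b k.
Proof.
have E (K : finType) (F : K -> R) (c : K) : \prod_k F k ^+ (k == c) = F c.
  by rewrite (bigD1 c)//= eqxx big1 ?mulr1// => k /negbTE->.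
rewrite big_sumType/=; under eq_bigr do rewrite exprD.
under [X in _ = _ * X]eq_bigr do rewrite exprD.
by rewrite !big_split/= !E mulrC.
Qed.

Lemma integral_monomial (a b : 'I_d * 'I_m) :
  P.-integrable [set: T] (fun w => (W a w * W b w * (h a.2 w * h b.2 w))%:E) /\
  (\int[P]_w (W a w * W b w * (h a.2 w * h b.2 w))%:E =
   (if a == b then tau ^+ 2 * v else 0)%:E)%E.
Proof.
have mF k : measurable_fun [set: R] (fun x : R => x ^+ deg a b k).
  exact: measurable_funX.
have deg2 k : (deg a b k <= 2)%N.
  by case: k => [l|c] /=; case: eqP => _; case: eqP.
have [iM ->] : P.-integrable [set: T]
      (fun w => (W a w * W b w * (h a.2 w * h b.2 w))%:E) /\
    (\int[P]_w (W a w * W b w * (h a.2 w * h b.2 w))%:E =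
     \prod_k \int[P]_w (X k w ^+ deg a b k)%:E)%E.
  under eq_fun do rewrite monomial_prod.
  exact: (integral_prod_independent mF mX indX (fun k => iX k (deg2 k))).
split=> //.
(* For distinct entries [W a] has exponent exactly 1, so its zero mean annihilates the product even
   when [a.2 = b.2]. *)
have [<-|ab] := eqVneq a b; last first.
  rewrite (bigD1 (inr a))//= eqxx (negbTE ab).
  by rewrite (integral_has_normal_law (sqr_ge0 _) (nW a)) mul0e.
rewrite (bigD1 (inr a))//= (bigD1 (inl a.2))//= !eqxx Eh.
rewrite (integral_sqr_has_normal_law (sqr_ge0 _) (nW a)).
have one0 (Y : T -> R) : (\int[P]_w (Y w ^+ (false + false)%N)%:E = 1%:E)%E.
  under eq_integral do rewrite -[(false + false)%N]/0%N expr0.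
  by rewrite integral_cst// mul1e; exact: probability_setT.
rewrite big1 ?mule1// => -[l|c] /andP[].
  rewrite -[inl l == inl a.2]/(l == a.2) /= => _ /negbTE->.
  exact: one0.
rewrite -[inr c == inr a]/(c == a) /= => /negbTE-> _.
exact: one0.
Qed.

Lemma integral_sqnorm_projection : orth_projector Q ->
  (\int[P]_w (sqnorm (Q *m ((\matrix_(j, l) W (j, l) w) *m
     (\col_l h l w))))%:E = ((\rank Q)%:R * tau ^+ 2 * m%:R * v)%:E)%E.
Proof.
move=> pQ.
(* Here [t = (i, (a, b))]: an output coordinate [i] and the entries of [W] chosen in the two copies
   of that coordinate. *)
pose c (t : 'I_d * (('I_d * 'I_m) * ('I_d * 'I_m))) :=
  Q t.1 t.2.1.1 * Q t.1 t.2.2.1.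
pose M (t : 'I_d * (('I_d * 'I_m) * ('I_d * 'I_m))) w :=
  W t.2.1 w * W t.2.2 w * (h t.2.1.2 w * h t.2.2.2 w).
have E w : (sqnorm (Q *m ((\matrix_(j, l) W (j, l) w) *m (\col_l h l w))))%:E =
    (\sum_t (c t)%:E * (M t w)%:E)%E.
  under [RHS]eq_bigr do rewrite -EFinM.
  rewrite sumEFin; congr (_%:E).
  rewrite -(pair_big xpredT xpredT (fun i t => c (i, t) * M (i, t) w))/=.
  apply: eq_bigr => i _.
  rewrite -(pair_big xpredT xpredT (fun a b => c (i, (a, b)) * M (i, (a, b)) w))/=.
  rewrite mxE; under [in LHS]eq_bigr do rewrite mxE big_distrr/=.
  rewrite pair_bigA/= expr2 big_distrlr/=.
  apply: eq_bigr => -[j l] _; apply: eq_bigr => -[j' l'] _.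
  by rewrite !mxE /c /M/=; ring.
under eq_integral do rewrite E.
rewrite integral_sum//=; last first.
  by move=> t; apply: integrableZl => //; exact: (integral_monomial _ _).1.
under eq_bigr => t _.
  rewrite integralZl//; last exact: (integral_monomial _ _).1.
  rewrite (integral_monomial _ _).2 -EFinM.
  over.
rewrite sumEFin; congr (_%:E).
rewrite -(pair_big xpredT xpredT (fun i t => c (i, t) *
  (if t.1 == t.2 then tau ^+ 2 * v else 0)))/=.
rewrite -(sum_sqr_projector pQ) !big_distrl/=; apply: eq_bigr => i _.
rewrite -(pair_big xpredT xpredT (fun a b => c (i, (a, b)) *
  (if a == b then tau ^+ 2 * v else 0)))/=.
rewrite !big_distrl/= -(pair_bigA _ (fun j l => \sum_b c (i, ((j, l), b)) *
  (if (j, l) == b then tau ^+ 2 * v else 0)))/=.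
apply: eq_bigr => j _.
(* Only [b = (j, l)] survives; the result does not depend on [l], whence the factor [m]. *)
rewrite (eq_bigr (fun=> Q i j ^+ 2 * (tau ^+ 2 * v))) => [|l _].
  by rewrite sumr_const card_ord -[LHS]mulr_natr; ring.
rewrite (bigD1 (j, l))//= eqxx big1 ?addr0 /c/=; first by rewrite -expr2.
by move=> b bjl; rewrite eq_sym (negbTE bjl) mulr0.
Qed.

End random_projection.

(** * Preactivations: joint independence and law *)

Section neurons.
Context {dT : measure_display} {T : measurableType dT} {R : realType}.
Variable P : probability T R.

Lemma independent_comp (I : finType) (X : I -> T -> R) (f : I -> R -> R) :
  (forall i, measurable_fun [set: R] (f i)) ->
  mutually_independent P X ->
  mutually_independent P (fun i w => f i (X i w)).
Proof.
move=> mf indX B mB; apply: (indX (fun i => f i @^-1` B i)) => i.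
by rewrite -[X in measurable X]setTI; exact: mf.
Qed.

Lemma gauss_expect_fin_num (nu : R) (f : R -> R) : 0 <= nu ->
  (forall s : R, 0 < s ->
    (normal_prob 0 s).-integrable [set: R] (fun y => (f y)%:E)) ->
  gauss_expect nu f \is a fin_num.
Proof.
move=> nu0 iF; rewrite /gauss_expect; have [//|n0] := eqVneq nu 0.
apply: integrable_fin_num => //; apply: iF.
by rewrite sqrtr_gt0 lt_neqAle eq_sym n0.
Qed.

Section sqr_integral.
Variables (nu : R) (f : R -> R) (Y : T -> R).
Hypotheses (mf : measurable_fun [set: R] f) (nY : has_normal_law P nu Y).

Lemma integral_sqr_comp : (\int[P]_w ((f (Y w)) ^+ 2)%:E =
  gauss_expect nu (fun y => ((f y) ^+ 2)%R))%E.
Proof.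
have mf2 : measurable_fun [set: R] (fun y => (f y) ^+ 2).
  exact: measurable_funX.
rewrite -integral_normal_law_gauss//.
apply: (ge0_integral_has_normal_law (f := fun y => ((f y) ^+ 2)%:E) nY).
  exact/measurable_EFinP.
by move=> y; rewrite lee_fin sqr_ge0.
Qed.

Lemma integrable_sqr_comp :
  gauss_expect nu (fun y => (f y) ^+ 2) \is a fin_num ->
  P.-integrable [set: T] (fun w => ((f (Y w)) ^+ 2)%:E).
Proof.
move=> fin; apply/integrableP; split.
  apply/measurable_EFinP; apply: measurable_funX.
  exact: (measurableT_comp mf nY.1).
under eq_integral do rewrite /= ger0_norm ?sqr_ge0//.
by rewrite integral_sqr_comp ltey_eq fin.
Qed.

End sqr_integral.

Section rows.
Variables (I J : finType) (d : nat) (x : 'cV[R]_d).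
Variables (A : I * 'I_d -> T -> R) (W : J -> T -> R).
Hypotheses (mA : forall i, measurable_fun [set: T] (A i)).
Hypotheses (mW : forall j, measurable_fun [set: T] (W j)).
Hypothesis indAW : mutually_independent P
  (fun k : I * 'I_d + J => match k with inl i => A i | inr j => W j end).

(** Each row of [A] is a block, weighted by [x] through [F]; each [W j] is a block of its own,
    carried along to stay independent of the rows. *)
Lemma independent_rows : mutually_independent P
  (fun k : I + J => match k with
    | inl i => fun w => \sum_k A (i, k) w * x k 0 | inr j => W j end).
Proof.
pose pi (k : I * 'I_d + J) : I + J :=
  match k with inl i => inl i.1 | inr j => inr j end.
pose F (k : I * 'I_d + J) (y : R) :=
  match k with inl i => y * x i.2 0 | inr _ => y end.
have mD : measurable_fun [set: R * R] (fun z => z.1 + z.2).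
  exact: measurable_funD.
have mF k : measurable_fun [set: R] (F k).
  case: k => [i|j]; last exact: measurable_id.
  by rewrite /F; apply: measurable_funM => //; exact: measurable_id.
have mAW (k : I * 'I_d + J) : measurable_fun [set: T]
    (match k with inl i => A i | inr j => W j end) by case: k.
have := independent_big pi 0 mD mF mAW indAW; congr mutually_independent.
apply/funext => -[i|j]; apply/funext => w; rewrite big_sumType/=.
- rewrite [X in _ + X]big1 ?addr0//.
  transitivity (\sum_(a | a == i) \sum_b A (a, b) w * x b 0).
    by rewrite pair_big/=; apply: eq_big => [[a b]|[a b] _] //=; rewrite andbT.
  by rewrite big_pred1_eq.
- by rewrite big1 ?add0r// big_pred1_eq.
Qed.

Lemma has_normal_law_row (sigma : R) (i : I) :
  (forall k, has_normal_law P (sigma ^+ 2) (A k)) ->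
  has_normal_law P (sigma ^+ 2 * sqnorm x)
    (fun w => \sum_k A (i, k) w * x k 0).
Proof.
move=> nA.
have nx k : has_normal_law P (x k 0 ^+ 2 * sigma ^+ 2)
    (fun w => x k 0 * A (i, k) w).
  exact: has_normal_law_scale (sqr_ge0 _) (nA _).
have hI : injective (fun k : 'I_d => inl (i, k) : I * 'I_d + J).
  by move=> k k' [].
have mM (k : 'I_d) : measurable_fun [set: R] (fun y => x k 0 * y).
  exact: measurable_funM.
have := has_normal_law_sum (fun k => mulr_ge0 (sqr_ge0 _) (sqr_ge0 _))
  (independent_comp mM (independent_sub hI indAW)) nx.
rewrite -mulr_suml mulrC.
by rewrite (_ : (fun w => _) = (fun w => \sum_k A (i, k) w * x k 0))//;
  apply/funext => w; apply: eq_bigr => k _; rewrite mulrC.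
Qed.

End rows.

End neurons.

(** * The single-branch and the gated network *)

Unset Implicit Arguments.

Theorem theorem2 (R : realType) (dT : measure_display) (T : measurableType dT)
  (P : probability T R) (d m r : nat) (sigma tau_s tau_g : R)
  (phi psi : R -> R)
  (Wi : T -> 'M[R]_(m, d)) (Wg Wu : T -> 'M[R]_(r, d))
  (Wo : T -> 'M[R]_(d, m)) (Wo' : T -> 'M[R]_(d, r))
  (x : 'cV[R]_d) (Pout : 'M[R]_d) :
  (0 < d)%N -> (0 < m)%N -> (0 < r)%N ->
  0 < sigma -> 0 < tau_s -> 0 < tau_g ->
  measurable_fun [set: R] phi -> measurable_fun [set: R] psi ->
  (forall s : R, 0 < s ->
     (normal_prob 0 s).-integrable [set: R] (fun y => ((phi y) ^+ 2)%:E)) ->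
  (forall s : R, 0 < s ->
     (normal_prob 0 s).-integrable [set: R] (fun y => ((psi y) ^+ 2)%:E)) ->
  mutually_independent P (all_entries Wi Wg Wu Wo Wo') ->
  (forall i j, gaussian_rv P sigma (fun w => Wi w i j)) ->
  (forall i j, gaussian_rv P sigma (fun w => Wg w i j)) ->
  (forall i j, gaussian_rv P sigma (fun w => Wu w i j)) ->
  (forall i j, gaussian_rv P tau_s (fun w => Wo w i j)) ->
  (forall i j, gaussian_rv P tau_g (fun w => Wo' w i j)) ->
  orth_projector Pout ->
  let nu := sigma ^+ 2 * sqnorm x in
  let E_single := (\int[P]_w (sqnorm (Pout *m F_single phi (Wi w) (Wo w) x))%:E)%E in
  let E_gate := (\int[P]_w (sqnorm (Pout *m F_gate psi (Wg w) (Wu w) (Wo' w) x))%:E)%E in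
  let E_phi := gauss_expect nu (fun y => (phi y) ^+ 2) in
  let E_psi := gauss_expect nu (fun y => (psi y) ^+ 2) in
  [/\ E_single = (((\rank Pout)%:R * tau_s ^+ 2 * m%:R)%:E * E_phi)%E,
      E_gate = (((\rank Pout)%:R * tau_g ^+ 2 * r%:R * nu)%:E * E_psi)%E &
      ((1 <= \rank Pout)%N -> (0 < E_phi)%E ->
        fine E_gate / fine E_single =
        (tau_g ^+ 2 / tau_s ^+ 2) * (r%:R / m%:R) * (nu * fine E_psi / fine E_phi))].
Proof.
move=> d0 m0 r0 sigma0 ts0 tg0 mphi mpsi iphi ipsi indX gWi gWg gWu gWo gWo' pP.
move=> nu E_single E_gate E_phi E_psi.
have nu0 : 0 <= nu by rewrite mulr_ge0 ?sqr_ge0// sumr_ge0// => i _; rewrite sqr_ge0.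
have fphi : E_phi \is a fin_num by exact: gauss_expect_fin_num.
have fpsi : E_psi \is a fin_num by exact: gauss_expect_fin_num.
have Es : E_single = (((\rank Pout)%:R * tau_s ^+ 2 * m%:R)%:E * E_phi)%E.
  pose A (i : 'I_m * 'I_d) w := Wi w i.1 i.2.
  pose W (a : 'I_d * 'I_m) w := Wo w a.1 a.2.
  pose e (k : 'I_m * 'I_d + 'I_d * 'I_m) : entry_index d m r :=
    match k with
    | inl i => inl (inl (inl (inl i)))
    | inr a => inl (inr a)
    end.
  have eI : injective e by move=> [i|a] [i'|a'] // [->].
  have nA i : has_normal_law P (sigma ^+ 2) (A i).
    exact: (gaussian_rv_normal_law sigma0 (gWi i.1 i.2)).
  have nW a : has_normal_law P (tau_s ^+ 2) (W a).
    exact: (gaussian_rv_normal_law ts0 (gWo a.1 a.2)).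
  have indAW : mutually_independent P (fun k : 'I_m * 'I_d + 'I_d * 'I_m =>
      match k with inl i => A i | inr j => W j end).
    have := independent_sub eI indX.
    by congr mutually_independent; apply/funext => -[[i k]|[j l]].
  pose h l w := phi (\sum_k A (l, k) w * x k 0).
  have nrow l := has_normal_law_row x indAW l nA.
  have mh l : measurable_fun [set: T] (h l).
    exact: (measurableT_comp mphi (nrow l).1).
  have indhW : mutually_independent P (fun k : 'I_m + 'I_d * 'I_m =>
      match k with inl l => h l | inr a => W a end).
    pose f (k : 'I_m + 'I_d * 'I_m) : R -> R :=
      match k with inl l => phi | inr a => id end.
    have mf k : measurable_fun [set: R] (f k).
      by case: k => [l|a]; [exact: mphi|exact: measurable_id].
    have := independent_comp mf (independent_rows x (fun i => (nA i).1)
      (fun a => (nW a).1) indAW).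
    by congr mutually_independent; apply/funext => -[].
  have ih l : P.-integrable [set: T] (fun w => (h l w ^+ 2)%:E).
    exact: integrable_sqr_comp mphi (nrow l) fphi.
  have Eh l : (\int[P]_w (h l w ^+ 2)%:E = (fine E_phi)%:E)%E.
    by rewrite (fineK fphi); exact: integral_sqr_comp mphi (nrow l).
  have := integral_sqnorm_projection indhW nW mh ih Eh pP.
  rewrite EFinM (fineK fphi) => <-.
  rewrite /E_single; apply: eq_integral => w _; congr ((sqnorm (_ *m _))%:E).
  by rewrite /F_single; congr (_ *m _);
    apply/matrixP => i j;
    rewrite ?ord1 !mxE.
have Eg : E_gate = (((\rank Pout)%:R * tau_g ^+ 2 * r%:R * nu)%:E * E_psi)%E.
  (* The rows of [Wg] and [Wu] are stacked, so that one use of [independent_rows] makes all [2 r]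
     preactivations and the output entries jointly independent. *)
  pose A (i : ('I_r + 'I_r) * 'I_d) w :=
    match i.1 with inl l => Wg w l i.2 | inr l => Wu w l i.2 end.
  pose W (a : 'I_d * 'I_r) w := Wo' w a.1 a.2.
  pose e (k : ('I_r + 'I_r) * 'I_d + 'I_d * 'I_r) : entry_index d m r :=
    match k with
    | inl (inl l, i) => inl (inl (inl (inr (l, i))))
    | inl (inr l, i) => inl (inl (inr (l, i)))
    | inr a => inr a
    end.
  have eI : injective e.
    by move=> [[[l|l] i]|a] [[[l'|l'] i']|a'] //; [case=> -> ->..|case=> ->].
  have nA i : has_normal_law P (sigma ^+ 2) (A i).
    case: i => [[l|l] i].
      exact: (gaussian_rv_normal_law sigma0 (gWg l i)).
    exact: (gaussian_rv_normal_law sigma0 (gWu l i)).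
  have nW a : has_normal_law P (tau_g ^+ 2) (W a).
    exact: (gaussian_rv_normal_law tg0 (gWo' a.1 a.2)).
  have indAW : mutually_independent P
      (fun k : ('I_r + 'I_r) * 'I_d + 'I_d * 'I_r =>
      match k with inl i => A i | inr j => W j end).
    have := independent_sub eI indX.
    by congr mutually_independent; apply/funext => -[[[l|l] k]|[j l]].
  pose y (i : 'I_r + 'I_r) w := \sum_k A (i, k) w * x k 0.
  have ny i : has_normal_law P nu (y i) := has_normal_law_row x indAW i nA.
  have my i : measurable_fun [set: T] (y i) := (ny i).1.
  have indy : mutually_independent P (fun k : 'I_r + 'I_r + 'I_d * 'I_r =>
      match k with inl i => y i | inr a => W a end) :=
    independent_rows x (fun i => (nA i).1) (fun a => (nW a).1) indAW.
  pose h l w := psi (y (inl l) w) * y (inr l) w.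
  have mh l : measurable_fun [set: T] (h l).
    by apply: measurable_funM => //; exact: (measurableT_comp mpsi).
  have indhW : mutually_independent P (fun k : 'I_r + 'I_d * 'I_r =>
      match k with inl l => h l | inr a => W a end).
    (* Blocks under multiplication: the two preactivations of neuron [l] share a fibre, and [F]
       applies [psi] to the gate half only. *)
    pose pi (k : 'I_r + 'I_r + 'I_d * 'I_r) : 'I_r + 'I_d * 'I_r :=
      match k with
      | inl (inl l) => inl l | inl (inr l) => inl l | inr a => inr a
      end.
    pose F (k : 'I_r + 'I_r + 'I_d * 'I_r) : R -> R :=
      match k with inl (inl l) => psi | _ => id end.
    have mF k : measurable_fun [set: R] (F k).
      by case: k => [[l|l]|a]; [exact: mpsi|exact: measurable_id..].
    have mM : measurable_fun [set: R * R] (fun z => z.1 * z.2).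
      exact: measurable_funM.
    have myW (k : 'I_r + 'I_r + 'I_d * 'I_r) : measurable_fun [set: T]
        (match k with inl i => y i | inr a => W a end).
      by case: k => [i|a]; [exact: my|exact: (nW a).1].
    have := independent_big pi 1 mM mF myW indy; congr mutually_independent.
    apply/funext => -[l|a]; apply/funext => w; rewrite !big_sumType/=.
      by rewrite [X in _ * X]big1 ?mulr1// !big_pred1_eq.
    by do 2 rewrite big1 ?mul1r//; rewrite big_pred1_eq.
  have ind2 l : independent2 P (fun w => psi (y (inl l) w) ^+ 2)
      (fun w => y (inr l) w ^+ 2).
    pose f (k : 'I_r + 'I_r + 'I_d * 'I_r) : R -> R :=
      match k with inl (inl l) => fun z => psi z ^+ 2 | _ => fun z => z ^+ 2 end.
    have mf k : measurable_fun [set: R] (f k).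
      by case: k => [[?|?]|?]; apply: measurable_funX => //; exact: measurable_id.
    exact: (mutually_independent2 (i := inl (inl l)) (j := inl (inr l)) isT
      (independent_comp mf indy)).
  have mprod l := integral_mul_independent2
    (measurable_funX 2 (measurableT_comp mpsi (my (inl l))))
    (measurable_funX 2 (my (inr l))) (@ind2 l)
    (integrable_sqr_comp mpsi (ny (inl l)) fpsi)
    (integrable_sqr_has_normal_law nu0 (ny (inr l))).
  have ih l : P.-integrable [set: T] (fun w => (h l w ^+ 2)%:E).
    by under eq_fun do rewrite exprMn; exact: (mprod l).1.
  have Eh l : (\int[P]_w (h l w ^+ 2)%:E = (nu * fine E_psi)%:E)%E.
    under eq_integral do rewrite exprMn.
    rewrite (mprod l).2 (integral_sqr_comp mpsi (ny _)) -/E_psi.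
    by rewrite (integral_sqr_has_normal_law nu0 (ny _)) [RHS]EFinM (fineK fpsi) muleC.
  have := integral_sqnorm_projection indhW nW mh ih Eh pP.
  rewrite mulrA EFinM (fineK fpsi) => <-.
  rewrite /E_gate; apply: eq_integral => w _; congr ((sqnorm (_ *m _))%:E).
  by rewrite /F_gate; congr (_ *m _);
    apply/matrixP => i j;
    rewrite ?ord1 !mxE.
split=> // rk0 Ephi0.
(* Finiteness of both Gaussian expectations turns the quotient into an identity between real
   fractions. *)
rewrite Es Eg -(fineK fphi) -(fineK fpsi) -!EFinM/=.
have p0 : fine E_phi != 0 by rewrite gt_eqF// -lte_fin fineK.
have R0 : (\rank Pout)%:R != 0 :> R by rewrite pnatr_eq0 -lt0n.
have m00 : m%:R != 0 :> R by rewrite pnatr_eq0 -lt0n.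
by field; rewrite p0 R0 m00 gt_eqF.
Qed.
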